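(* Let $1<p<q<\infty$. Let $(\mathcal{A},\xi_0)$ be a tree rooted at $\xi_0$ with finite or countable vertex set, and let $u,w:\mathbf{V}(\mathcal{A})\to[0,\infty)$ satisfy $u(\xi)=u_j$, $w(\xi)=w_j$ for all $\xi\in\mathbf{V}_j^{\mathcal{A}}(\xi_0)$, $j\in\mathbb{Z}_+$, for some nonnegative numbers $u_j,w_j$. Suppose there exist a number $C_*\ge1$, numbers $R_0\ge R>1$, and a function $S:\mathbb{Z}_+\to(0,\infty)$ such that (i) $C_*^{-1}\frac{S(j')}{S(j)}\le \operatorname{card}\mathbf{V}^{\mathcal{A}}_{j'-j}(\xi)\le C_*\frac{S(j')}{S(j)}$ for all $j\in\mathbb{Z}_+$, all $\xi\in\mathbf{V}^{\mathcal{A}}_j(\xi_0)$ and all $j'\ge j$; (ii) $S(0)=1$; (iii) $R_0\ge \frac{S(j+1)}{S(j)}\ge R$ for all $j\in\mathbb{Z}_+$. Let $\hat{\mathfrak{S}}^{p,q}_{\mathcal{A},u,w}\in[0,\infty]$ be the operator norm of $S_{u,w,\mathcal{A}}f(\xi)=w(\xi)\sum_{\xi'\le\xi}u(\xi')f(\xi')$ from $l_q(l_p(\mathcal{A}))$ to $l_q(\mathcal{A})$. Then $$\hat{\mathfrak{S}}^{p,q}_{\mathcal{A},u,w}\asymp \sup_{j\in\mathbb{Z}_+}u_j\Big(\sum_{i\ge j}w_i^q\frac{S(i)}{S(j)}\Big)^{1/q}\asymp\sup_{\xi\in\mathbf{V}(\mathcal{A})}u(\xi)\|w\|_{l_q(\mathcal{A}_\xi)},$$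 where $A\asymp B$ means there are constants $c_1,c_2>0$ depending only on $p,q,C_*,R,R_0$ with $c_1B\le A\le c_2B$ (both sides possibly infinite).
   Context: Graphs have no loops or multiple edges. Partial order on $\mathbf{V}(\mathcal{A})$: $\xi'>\xi$ if there is a simple path $(\xi_0,\xi_1,\dots,\xi_n,\xi')$ with $\xi=\xi_k$ for some $k\in\{0,\dots,n\}$, and then the distance is $\rho(\xi,\xi')=n+1-k$; $\rho(\xi,\xi)=0$; $\xi'\ge\xi$ means $\xi'>\xi$ or $\xi'=\xi$. For $j\in\mathbb{Z}_+$ and $\xi\in\mathbf{V}(\mathcal{A})$, $\mathbf{V}^{\mathcal{A}}_j(\xi)=\{\xi'\ge\xi:\rho(\xi,\xi')=j\}$. $\mathcal{A}_\xi$ is the subtree with vertex set $\{\xi'\ge\xi\}$. $\|g\|_{l_q(\mathcal{G})}=\big(\sum_{\xi\in\mathbf{V}(\mathcal{G})}|g(\xi)|^q\big)^{1/q}$, and $l_q(\mathcal{A})$ is the space of $g:\mathbf{V}(\mathcal{A})\to\mathbb{R}$ with finite norm. The mixed norm is $\|f\|_{l_q(l_p(\mathcal{A}))}=\Big(\sum_{j=0}^\infty\Big(\sum_{\xi\in\mathbf{V}_j^{\mathcal{A}}(\xi_0)}|f(\xi)|^p\Big)^{q/p}\Big)^{1/q}$, and $l_q(l_p(\mathcal{A}))$ is the space of functions with finite such norm; the operator norm is the minimal $C$ with $\|S_{u,w,\mathcal{A}}f\|_{l_q(\mathcal{A})}\le C\|f\|_{l_q(l_p(\mathcal{A}))}$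 for all $f$. *)

(* Defs.v *)
From HB Require Import structures.
From mathcomp Require Import all_boot all_order all_algebra.
From mathcomp Require Import all_classical all_reals all_analysis.
Set Implicit Arguments. Unset Strict Implicit. Unset Printing Implicit Defensive.
Import Order.TTheory GRing.Theory Num.Theory.
Local Open Scope classical_set_scope.
Local Open Scope ring_scope.

(* A rooted tree on the vertex type V is encoded by its root and the parent
   map [par]: the root is the only fixed point reached, every vertex reaches
   the root by iterating [par]. Edges are {v, par v} for v <> root. *)
Definition is_rooted_tree (V : Type) (par : V -> V) (root : V) : Prop :=
  par root = root /\ forall v, exists n, iter n par v = root.

(* V_j(xi): vertices xi' >= xi at distance j, i.e. the upward simple path from
   xi' of length j ends at xi (and does not visit xi earlier). *)
Definition level_set (V : Type) (par : V -> V) (xi : V) (j : nat) : set V :=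
  [set xi' | iter j par xi' = xi /\ forall k, (k < j)%N -> iter k par xi' <> xi].

Definition tle (V : Type) (par : V -> V) (xi xi' : V) : Prop :=
  exists j, level_set par xi j xi'.

Definition subtree (V : Type) (par : V -> V) (xi : V) : set V := [set xi' | tle par xi xi'].

Definition Sop (R : realType) (V : choiceType) (par : V -> V)
    (u w f : V -> R) (xi : V) : R :=
  w xi * (\sum_(xi' \in [set y | tle par y xi]) (u xi' * f xi'))%R.

Definition lq_norm (R : realType) (V : choiceType) (q : R) (G : set V) (g : V -> R) : \bar R :=
  ((\esum_(xi in G) ((`|g xi| `^ q)%:E)) `^ q^-1)%E.

Definition lqlp_norm (R : realType) (V : choiceType) (par : V -> V) (root : V)
    (p q : R) (f : V -> R) : \bar R :=
  ((\esum_(j in [set: nat])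
      ((\esum_(xi in level_set par root j) ((`|f xi| `^ p)%:E)) `^ (q / p)))
    `^ q^-1)%E.

Definition op_norm (R : realType) (V : choiceType) (par : V -> V) (root : V)
    (p q : R) (u w : V -> R) : \bar R :=
  ereal_inf [set C : \bar R | (0 <= C)%E /\
    forall f : V -> R, (lqlp_norm par root p q f < +oo)%E ->
      (lq_norm q [set: V] (Sop par u w f) <= C * lqlp_norm par root p q f)%E].

Definition asymp (R : realType) (c1 c2 : R) (A B : \bar R) : Prop :=
  (c1%:E * B <= A)%E /\ (A <= c2%:E * B)%E.

(* Main.v *)
(** Testing the operator on the indicator of a vertex bounds its norm below by
the supremum over vertices, and counting the vertices of [subtree par xi] level
by level compares the two suprema. For the upper bound it suffices to show, on
each level [i], with [M k] the [l_p] norm of [f] on level [k],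
  [sum_{x in V_i} (sum_{k <= i} f x_k)^q <= C S_i sum_{k <= i} (M k)^q / S_k],
where [x_k] is the ancestor of [x] on level [k]; one then replaces [f] by [u f],
multiplies by [w_i^q], sums over [i] and exchanges the sums. This level estimate
is where [p < q] and the growth of [S] enter. Let [m_k = (M k)^q / S_k] and let
[K] be the convolution of [m] with a geometric kernel, so that [m <= K], that
[sum K <= C sum m], and that [L = S K] still grows geometrically. With
[t_k = f x_k / M k], which is at most [1], one has [f x_k <= L_k^(1/q) t_k], and
pointwise [(sum L_k^(1/q) t_k)^q <= C sum L_k t_k^p]; summing [t_k^p] over [V_i]
gives at most [C S_i / S_k]. *)
Require Import Defs.
From HB Require Import structures.
From mathcomp Require Import all_boot all_order all_algebra.
From mathcomp Require Import all_classical all_reals all_analysis.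
From mathcomp Require Import ring lra zify.
Set Implicit Arguments. Unset Strict Implicit. Unset Printing Implicit Defensive.
Import Order.TTheory GRing.Theory Num.Theory.
Local Open Scope classical_set_scope.
Local Open Scope ring_scope.

(** * Geometric sums and powers of sums *)

(** Read from the largest down, the terms below the threshold are dominated by [y], [y / al],
    [y / al ^ 2] and so on. The induction removes the last term: once [a n <= y], every earlier term
    is at most [a n / al], which becomes the new threshold. *)
Lemma sum_le_geometric_up (R : realType) (al : R) (a : nat -> R) :
  1 < al -> (forall k, 0 <= a k) -> (forall k, al * a k <= a k.+1) ->
  forall n y, 0 <= y ->
  \sum_(k < n | a k <= y) a k <= al / (al - 1) * y.
Proof.
move=> al1 a0 ag; have c0 : 0 <= al / (al - 1) by apply: divr_ge0; lra.
have amono k d : al * a k <= a (k + d.+1)%N.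
  elim: d => [|d IH]; first by rewrite addn1.
  rewrite addnS; apply: (le_trans IH); apply: le_trans (ag _).
  by rewrite -[leLHS]mul1r ler_wpM2r // ltW.
elim=> [|n IH] y y0; first by rewrite big_ord0 mulr_ge0.
rewrite big_mkcond big_ord_recr /= -big_mkcond /=.
case: ifPn => any; last by rewrite addr0 IH.
have al0 : 0 < al by rewrite (lt_trans ltr01).
have -> : al / (al - 1) * y = al / (al - 1) * (y / al) + y.
  by field; apply/andP; split; rewrite ?subr_eq0 gt_eqF.
apply: lerD => //.
have Hle : a n / al <= y / al by rewrite ler_wpM2r // invr_ge0 ltW.
apply: (@le_trans _ _ (\sum_(k < n | a k <= a n / al) a k)).
  rewrite [leLHS]big_mkcond [leRHS]big_mkcond /=; apply: ler_sum => k _.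
  rewrite ler_pdivlMr // mulrC.
  have -> : al * a k <= a n.
    by have := amono k (n - k.+1)%N; rewrite addnS -addSn subnKC // ltn_ord.
  by case: ifP.
apply: (le_trans (IH _ _)); first by rewrite divr_ge0 // ltW.
exact: ler_wpM2l.
Qed.

(** The largest term now comes first, so the induction removes [b 0] and passes to the shifted
    sequence; this is why [b] is quantified after [n]. *)
Lemma sum_le_geometric_down (R : realType) (be : R) :
  0 <= be -> be < 1 -> forall n (b : nat -> R), (forall k, 0 <= b k) ->
  (forall k, b k.+1 <= be * b k) ->
  forall y, 0 <= y -> \sum_(k < n | b k <= y) b k <= y / (1 - be).
Proof.
move=> be0 be1; have c0 : 0 < 1 - be by rewrite subr_gt0.
elim=> [|n IH] b b0 bg y y0; first by rewrite big_ord0 divr_ge0 // ltW.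
have bmono k : b k.+1 <= be * b 0%N.
  elim: k => [|k IHk] //; apply: (le_trans (bg _)); apply: ler_wpM2l => //.
  by apply: (le_trans IHk); rewrite -[leRHS]mul1r ler_wpM2r // ltW.
rewrite big_mkcond big_ord_recl /= -[X in _ + X]big_mkcond /=.
have IHs := IH (fun k => b k.+1) (fun k => b0 _) (fun k => bg _).
case: ifPn => b0y; last by rewrite add0r; apply: IHs.
apply: (@le_trans _ _ (b 0%N + \sum_(i < n | b i.+1 <= be * b 0%N) b i.+1)).
  rewrite lerD2l [leLHS]big_mkcond [leRHS]big_mkcond /=; apply: ler_sum => k _.
  by rewrite bmono; case: ifP.
apply: (@le_trans _ _ (b 0%N + be * b 0%N / (1 - be))).
  by rewrite lerD2l; apply: IHs; rewrite mulr_ge0.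
have -> : b 0%N + be * b 0%N / (1 - be) = b 0%N / (1 - be).
  by field; rewrite gt_eqF.
by rewrite ler_wpM2r // invr_ge0 ltW.
Qed.

(* With Y the sum on the right, t_k <= min(1, (Y / L_k)^(1/p)), so the left-hand
   sum is at most an increasing geometric sum over L_k <= Y plus a decreasing
   one over L_k > Y, and both are comparable to Y^(1/q). *)
Lemma powR_sum_geometric (R : realType) (p q rho : R) :
  0 < p -> p < q -> 1 < rho -> exists2 C : R, 0 < C &
  forall n (L t : nat -> R), (forall k, 0 < L k) ->
    (forall k, rho * L k <= L k.+1) ->
    (forall k, (k < n)%N -> 0 <= t k <= 1) ->
    (\sum_(k < n) L k `^ q^-1 * t k) `^ q <= C * \sum_(k < n) L k * t k `^ p.
Proof.
move=> p0 pq rho1.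
have q0 : 0 < q by apply: lt_trans pq.
have rho0 : 0 < rho by apply: lt_trans rho1.
(* Where [L_k > Y] one has [L_k^(1/q) (Y / L_k)^(1/p) = Y^(1/p) L_k^(-s)], which decays
   geometrically because [p < q] makes [s] positive. *)
pose s := p^-1 - q^-1.
have s0 : 0 < s by rewrite subr_gt0 ltf_pV2.
have powR_gt1 e : 0 < e -> 1 < rho `^ e.
  by move=> e0; have := @gt0_ltr_powR _ e e0 1 rho;
    rewrite powR1 !nnegrE; apply => //; rewrite ltW.
pose al := rho `^ q^-1; pose be := rho `^ (- s).
have al1 : 1 < al by apply: powR_gt1; rewrite invr_gt0.
have be0 : 0 < be by rewrite powR_gt0.
have be1 : be < 1 by rewrite /be powRN invf_lt1 ?powR_gt0 // powR_gt1.
(* The two summands are the constants for the increasing part [L_k <= Y] and the decreasing part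
   [L_k > Y]. *)
pose c := al / (al - 1) + (1 - be)^-1.
have c0 : 0 < c.
  by rewrite addr_gt0 // ?invr_gt0 ?subr_gt0 // divr_gt0 ?subr_gt0 // (lt_trans ltr01).
exists (c `^ q); first by rewrite powR_gt0.
move=> n L t L0 Lg t01.
set Y := \sum_(k < n) L k * t k `^ p.
have Yk (k : 'I_n) : L k * t k `^ p <= Y.
  rewrite /Y (bigD1 k) //= lerDl sumr_ge0 // => i _.
  by rewrite mulr_ge0 ?powR_ge0 // ltW.
have Y0 : 0 <= Y by apply: sumr_ge0 => i _; rewrite mulr_ge0 ?powR_ge0 // ltW.
suff X : \sum_(k < n) L k `^ q^-1 * t k <= c * Y `^ q^-1.
  rewrite -[Y in leRHS](@powRr1 _ Y) // -(mulVf (lt0r_neq0 q0)) powRrM.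
  rewrite -powRM ?powR_ge0 //; last exact: ltW.
  apply: ge0_ler_powR; rewrite ?nnegrE ?(ltW q0) // ?mulr_ge0 ?powR_ge0 ?(ltW c0) //.
  by apply: sumr_ge0 => k _; have /andP[? _] := t01 _ (ltn_ord k);
    rewrite mulr_ge0 // powR_ge0.
(* If [Y = 0] every [t k] vanishes; otherwise negative powers of [Y] are available. *)
move: Y0; rewrite le_eqVlt => /predU1P[Yz|Y0].
  rewrite big1 ?mulr_ge0 ?powR_ge0 ?(ltW c0) // => k _.
  have := Yk k; rewrite -Yz pmulr_rle0 // => tk.
  have /eqP : t k `^ p = 0 by apply/eqP; rewrite eq_le tk powR_ge0.
  by rewrite powR_eq0 => /andP[/eqP -> _]; rewrite mulr0.
have tb (k : 'I_n) : t k <= (Y / L k) `^ p^-1.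
  have /andP[tk0 _] := t01 _ (ltn_ord k).
  rewrite -[leLHS]powRr1 // -(mulfV (lt0r_neq0 p0)) powRrM.
  apply: ge0_ler_powR; rewrite ?nnegrE ?invr_ge0 ?(ltW p0) ?powR_ge0 //
    ?divr_ge0 ?(ltW Y0) ?(ltW (L0 _)) //.
  by rewrite ler_pdivlMr // mulrC.
pose a k := L k `^ q^-1; pose b k := L k `^ (- s).
have ag k : al * a k <= a k.+1.
  rewrite /al /a -powRM ?(ltW rho0) ?(ltW (L0 _)) //.
  apply: ge0_ler_powR; rewrite ?nnegrE ?invr_ge0 ?(ltW q0)
    ?mulr_ge0 ?(ltW (L0 _)) ?(ltW rho0) //.
have bg k : b k.+1 <= be * b k.
  rewrite /be /b -powRM ?(ltW rho0) ?(ltW (L0 _)) // !powRN.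
  rewrite lef_pV2 ?posrE ?powR_gt0 ?mulr_gt0 //.
  by apply: ge0_ler_powR; rewrite ?nnegrE ?(ltW s0) ?mulr_ge0 ?(ltW (L0 _)) ?(ltW rho0).
(* The tests [a k <= Y^(1/q)] and [b k <= Y^(-s)] restate [L k <= Y] and [L k >= Y] in the form that
   the two geometric lemmas expect. *)
have step (k : 'I_n) : L k `^ q^-1 * t k <=
    (if a k <= Y `^ q^-1 then a k else 0) +
    Y `^ p^-1 * (if b k <= Y `^ (- s) then b k else 0).
  have /andP[tk0 tk1] := t01 _ (ltn_ord k).
  have [LY|YL] := leP (L k) Y.
    have -> : a k <= Y `^ q^-1.
      by apply: ge0_ler_powR; rewrite ?nnegrE ?invr_ge0 ?(ltW q0) ?(ltW (L0 _)) ?(ltW Y0).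
    apply: (@le_trans _ _ (a k)); first by rewrite ler_piMr // powR_ge0.
    by rewrite lerDl mulr_ge0 ?powR_ge0 //; case: ifP; rewrite ?powR_ge0.
  have -> : b k <= Y `^ (- s).
    rewrite /b !powRN lef_pV2 ?posrE ?powR_gt0 //.
    by apply: ge0_ler_powR; rewrite ?nnegrE ?(ltW s0) ?(ltW (L0 _)) ?(ltW Y0) ?(ltW YL).
  apply: (@le_trans _ _ (Y `^ p^-1 * b k)); last first.
    by rewrite lerDr; case: ifP; rewrite ?powR_ge0.
  apply: (@le_trans _ _ (L k `^ q^-1 * (Y / L k) `^ p^-1)).
    by rewrite ler_wpM2l ?powR_ge0.
  rewrite powRM ?(ltW Y0) ?invr_ge0 ?(ltW (L0 _)) // mulrCA ler_wpM2l ?powR_ge0 //.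
  rewrite -[X in X `^ p^-1]powR_inv1 ?(ltW (L0 _)) // -powRrM -powRD.
    by rewrite mulN1r /b /s opprB.
  by rewrite (gt_eqF (L0 _)) implybT.
apply: (le_trans (ler_sum _ (fun k _ => step k))).
rewrite big_split /= -big_mkcond /= -mulr_sumr -big_mkcond /= mulrDl.
apply: lerD.
  by apply: sum_le_geometric_up => //; rewrite ?powR_ge0 // => k; rewrite powR_ge0.
apply: (@le_trans _ _ (Y `^ p^-1 * (Y `^ (- s) / (1 - be)))).
  rewrite ler_wpM2l ?powR_ge0 //.
  by apply: sum_le_geometric_down; rewrite ?powR_ge0 ?(ltW be0) // => k; rewrite powR_ge0.
by rewrite mulrA -powRD ?(gt_eqF Y0) ?implybT // /s opprB subrKC mulrC.
Qed.

(** * Smoothing by a two-sided geometric kernel *)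

(** The exponent is [|k - j|], written with truncated subtraction. *)
Lemma sum_expr_dist (R : realType) (la : R) : 0 <= la -> la < 1 ->
  forall n j : nat, \sum_(k < n) la ^+ ((k - j) + (j - k))%N <= 2 / (1 - la).
Proof.
move=> la0 la1; have d0 : 0 < 1 - la by rewrite subr_gt0.
(* The new bound is the exact sum of the series over all natural [k]. This sharper form survives the
   induction, where removing [k = 0] lowers [n] and, if positive, [j]. *)
suff H n j : \sum_(k < n) la ^+ ((k - j) + (j - k))%N <= (1 + la - la ^+ j.+1) / (1 - la).
  move=> n j; apply: (le_trans (H n j)); rewrite ler_pM2r ?invr_gt0 //.
  by have := exprn_ge0 j.+1 la0; lra.
elim: n j => [|n IH] j.
  rewrite big_ord0 divr_ge0 ?(ltW d0) //.
  by have := exprn_ile1 j.+1 la0 (ltW la1); lra.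
rewrite big_ord_recl /=.
case: j => [|j].
  rewrite subnn addn0 expr0 expr1.
  under eq_bigr do rewrite /= subn0 sub0n addn0 exprS.
  rewrite -mulr_sumr.
  have := IH 0%N; under eq_bigr do rewrite subn0 sub0n addn0.
  rewrite expr1 addrK => {}IH.
  have -> : 1 / (1 - la) = 1 + la * (1 / (1 - la)) by field; rewrite gt_eqF.
  by rewrite lerD2l ler_wpM2l.
rewrite sub0n add0n subn0.
under eq_bigr do rewrite /= !subSS.
have -> : (1 + la - la ^+ j.+2) / (1 - la) = la ^+ j.+1 + (1 + la - la ^+ j.+1) / (1 - la).
  by rewrite (exprS _ j.+1); field; rewrite gt_eqF.
by rewrite lerD2l.
Qed.

(* Any ratio in the interval (1/Rr, 1) would do. *)
Definition smoothing_ratio (R : realType) (Rr : R) : R := (Rr + 1) / (2 * Rr).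

(** The convolution of [m], cut off at [n], with the kernel [la ^ |k - j|]. The index [k] may exceed
    [n], so positivity and growth can be stated for every [k]. *)
Definition smoothed (R : realType) (la : R) (n : nat) (m : nat -> R) (k : nat) : R :=
  \sum_(j < n) la ^+ ((k - j) + (j - k))%N * m j.

(** The kernel is summable because the ratio is below 1, while [S k * K k] still grows at least by
    the factor [Rr * la > 1]. *)
Lemma smoothing_ratioP (R : realType) (Rr : R) : 1 < Rr ->
  [/\ 0 < smoothing_ratio Rr, smoothing_ratio Rr < 1 & 1 < Rr * smoothing_ratio Rr].
Proof.
move=> Rr1; have Rr0 : 0 < Rr by lra.
rewrite /smoothing_ratio; split.
- by rewrite divr_gt0 //; lra.
- by rewrite ltr_pdivrMr; lra.
- have -> : Rr * ((Rr + 1) / (2 * Rr)) = (Rr + 1) / 2 by field; rewrite gt_eqF.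
  lra.
Qed.

Lemma smoothed_ge (R : realType) (la : R) n (m : nat -> R) k :
  0 <= la -> (forall j, 0 <= m j) -> (k < n)%N -> m k <= smoothed la n m k.
Proof.
move=> la0 m0 kn; rewrite /smoothed (bigD1 (Ordinal kn)) //= subnn addn0 expr0 mul1r.
by rewrite lerDl sumr_ge0 // => j _; rewrite mulr_ge0 ?exprn_ge0.
Qed.

Lemma smoothed_gt0 (R : realType) (la : R) n (m : nat -> R) k i :
  0 < la -> (forall j, 0 <= m j) -> (i < n)%N -> 0 < m i -> 0 < smoothed la n m k.
Proof.
move=> la0 m0 kn mi; rewrite /smoothed (bigD1 (Ordinal kn)) //=.
rewrite ltr_pwDl // ?mulr_gt0 ?exprn_gt0 //.
by rewrite sumr_ge0 // => j _; rewrite mulr_ge0 ?exprn_ge0 // ltW.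
Qed.

(** Passing from [k] to [k.+1] raises each distance [|k - j|] by at most 1, which costs at most one
    factor [la]. *)
Lemma smoothedS (R : realType) (la : R) n (m : nat -> R) k :
  0 <= la -> la <= 1 -> (forall j, 0 <= m j) ->
  la * smoothed la n m k <= smoothed la n m k.+1.
Proof.
move=> la0 la1 m0; rewrite mulr_sumr; apply: ler_sum => j _.
rewrite mulrA -exprS ler_wpM2r // ler_wiXn2l //; lia.
Qed.

Lemma sum_smoothed (R : realType) (la : R) n (m : nat -> R) :
  0 <= la -> la < 1 -> (forall j, 0 <= m j) ->
  \sum_(k < n) smoothed la n m k <= 2 / (1 - la) * \sum_(j < n) m j.
Proof.
move=> la0 la1 m0; rewrite exchange_big /= mulr_sumr; apply: ler_sum => j _.
by rewrite -mulr_suml ler_wpM2r // sum_expr_dist.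
Qed.

(** Here [F k] stands for [(M k)^p]. The inequality [powR_sum_geometric] is applied to [L = S K] and
    [t k = x k / F k ^ (1 / p)]; the bound [m <= K] gives [F k ^ (1 / p) <= L k ^ (1 / q)]. *)
Lemma powR_chain_sum (R : realType) (p q Rr : R) :
  0 < p -> p < q -> 1 < Rr -> exists2 C : R, 0 < C &
  forall n (S F x : nat -> R), (forall k, 0 < S k) ->
    (forall k, Rr * S k <= S k.+1) -> (forall k, 0 <= F k) ->
    (forall k, (k < n)%N -> 0 <= x k /\ x k `^ p <= F k) ->
    (\sum_(k < n) x k) `^ q <= C * \sum_(k < n)
      S k * smoothed (smoothing_ratio Rr) n (fun j => F j `^ (q / p) / S j) k
      * (x k `^ p / F k).
Proof.
move=> p0 pq Rr1; have [la0 la1 rho1] := smoothing_ratioP Rr1.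
set la := smoothing_ratio Rr in la0 la1 rho1 *.
have q0 : 0 < q by apply: lt_trans pq.
have [C C0 HC] := powR_sum_geometric p0 pq rho1.
exists C => // n S F x S0 Sg F0 Hx.
set m := fun j => F j `^ (q / p) / S j.
have m0 j : 0 <= m j by rewrite divr_ge0 ?powR_ge0 ?ltW.
have xF0 k : (k < n)%N -> F k = 0 -> x k = 0.
  move=> kn Fk; have [xk0 xkF] := Hx k kn.
  have /eqP : x k `^ p = 0 by apply/eqP; rewrite eq_le powR_ge0 -[X in _ <= X]Fk xkF.
  by rewrite powR_eq0 => /andP[/eqP].
(* A single positive [m i] makes [K] positive at every index, as [L > 0] requires. If there is none,
   all [F k] and hence all [x k] with [k < n] vanish. *)
have [[i /andP[iN mi]]|nom] := pselect (exists i, (i < n)%N && (0 < m i)); last first.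
  rewrite big1 ?powR0 ?(gt_eqF q0) // => [|k _].
    rewrite mulr_ge0 ?(ltW C0) // sumr_ge0 // => k _.
    rewrite !mulr_ge0 ?invr_ge0 ?powR_ge0 ?(ltW (S0 _)) // sumr_ge0 // => j _.
    by rewrite mulr_ge0 ?exprn_ge0 ?m0 ?(ltW la0).
  apply: xF0 => //; apply/eqP; apply: contra_notT nom => Fk; exists k.
  by rewrite ltn_ord /= divr_gt0 // powR_gt0 // lt0r Fk F0.
pose K := smoothed la n m.
have K0 k : 0 < K k by apply: smoothed_gt0 mi.
(* If [F k = 0] the quotient is 0 by convention, in agreement with [x k = 0]. *)
pose t k := x k / F k `^ p^-1.
have tp k : (k < n)%N -> t k `^ p = x k `^ p / F k.
  move=> kn; have [xk0 _] := Hx k kn.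
  rewrite /t powRM ?invr_ge0 ?powR_ge0 // -powR_inv1 ?powR_ge0 // -!powRrM.
  rewrite mulrCA mulVf ?mulr1; last by rewrite gt_eqF.
  by rewrite powR_inv1.
have t01 k : (k < n)%N -> 0 <= t k <= 1.
  move=> kn; have [xk0 xkF] := Hx k kn.
  rewrite divr_ge0 ?powR_ge0 //=.
  have [Fk|Fk] := eqVneq (F k) 0; first by rewrite /t (xF0 _ kn Fk) mul0r.
  have Fk0 : 0 < F k by rewrite lt0r Fk F0.
  rewrite ler_pdivrMr ?powR_gt0 // mul1r.
  rewrite -[leLHS]powRr1 // -(mulfV (lt0r_neq0 p0)) powRrM.
  by apply: ge0_ler_powR; rewrite ?nnegrE ?invr_ge0 ?(ltW p0) ?powR_ge0.
have := HC n (fun k => S k * K k) t.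
move=> /(_ (fun k => mulr_gt0 (S0 k) (K0 k))) /(_ _ t01) H.
apply: le_trans (le_trans (H _) _); last 1 first.
- by rewrite ler_pM2l //; apply: ler_sum => k _; rewrite tp.
- apply: ge0_ler_powR; rewrite ?nnegrE ?(ltW q0) //.
  + by apply: sumr_ge0 => k _; have [] := Hx _ (ltn_ord k).
  + apply: sumr_ge0 => k _; rewrite mulr_ge0 ?powR_ge0 //.
    by have /andP[] := t01 _ (ltn_ord k).
  + apply: ler_sum => k _; have [xk0 _] := Hx _ (ltn_ord k).
    have [Fk|Fk] := eqVneq (F k) 0; first by rewrite /t (xF0 _ (ltn_ord k) Fk) mul0r mulr0.
    have Fk0 : 0 < F k by rewrite lt0r Fk F0.
    rewrite /t mulrCA -[leLHS]mulr1 ler_wpM2l //.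
    rewrite ler_pdivlMr ?powR_gt0 // mul1r.
    have -> : p^-1 = q / p * q^-1 by field; rewrite !gt_eqF.
    rewrite powRrM; apply: ge0_ler_powR; rewrite ?nnegrE ?invr_ge0 ?(ltW q0) ?powR_ge0 //.
      by rewrite mulr_ge0 // ltW.
    rewrite [leRHS]mulrC -ler_pdivrMr //.
    exact: (smoothed_ge (ltW la0) m0 (ltn_ord k)).
- move=> k; rewrite mulrACA; apply: ler_pM.
  + by rewrite mulr_ge0 ?(ltW (S0 _)) //; lra.
  + by rewrite mulr_ge0 ?(ltW (K0 _)) ?(ltW la0).
  + exact: Sg.
  + exact: (smoothedS n k (ltW la0) (ltW la1) m0).
Qed.

(** * Unordered sums and powers in the extended reals *)

(** The inequality [le_Z] comes from finite subsums; the converse is the same inequality for the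
    factor [c^-1]. *)
Lemma ge0_esumZl (R : realType) (T : choiceType) (I : set T) (a : T -> \bar R) (c : R) :
  (forall i, (0 <= a i)%E) -> 0 <= c ->
  (\esum_(i in I) (c%:E * a i) = c%:E * \esum_(i in I) a i)%E.
Proof.
have le_Z d (b : T -> \bar R) : 0 <= d -> (forall i, (0 <= b i)%E) ->
    (\esum_(i in I) (d%:E * b i) <= d%:E * \esum_(i in I) b i)%E.
  move=> d0 b0; apply: ge_ereal_sup => _ [X [finX XI] <-].
  rewrite -ge0_mule_fsumr // lee_wpmul2l ?lee_fin //.
  by apply: esum_ge; exists X.
move=> a0; rewrite le_eqVlt => /predU1P[<-|c0].
  by rewrite mul0e esum1 // => i _; rewrite mul0e.
apply/eqP; rewrite eq_le le_Z ?(ltW c0) //=.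
rewrite -lee_pdivlMl //; apply: le_trans (le_Z c^-1 _ _ _).
- by apply: le_esum => i _; rewrite muleA -EFinM mulVf ?gt_eqF // mul1e.
- by rewrite invr_ge0 ltW.
- by move=> i; rewrite mule_ge0 // lee_fin ltW.
Qed.

Lemma esum_subset (R : realType) (T : choiceType) (A B : set T) (a : T -> \bar R) :
  A `<=` B -> (\esum_(i in A) a i <= \esum_(i in B) a i)%E.
Proof.
move=> AB; apply: le_ereal_sup => _ [X [finX XA] <-].
by exists X => //; split => // x /XA /AB.
Qed.

Lemma esum_ge_term (R : realType) (T : choiceType) (A : set T) (a : T -> \bar R) x :
  A x -> (a x <= \esum_(i in A) a i)%E.
Proof.
move=> Ax; apply: esum_ge; exists [set x]; last by rewrite fsbig_set1.
by split => // _ ->.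
Qed.

Lemma esum_single (R : realType) (T : choiceType) (A : set T) (a : T -> \bar R) x :
  A x -> (0 <= a x)%E -> (forall y, A y -> y <> x -> a y = 0%E) ->
  (\esum_(i in A) a i)%E = a x.
Proof.
move=> Ax ax0 az; have a0 y : A y -> (0 <= a y)%E.
  by move=> Ay; have [->//|/eqP yx] := eqVneq y x; rewrite az.
rewrite (esumID [set x]) // [X in (_ + X)%E]esum1 ?adde0; last first.
  by move=> y [Ay yx]; rewrite az.
rewrite (_ : A `&` [set x] = [set x]) ?esum_set1 //.
by apply/seteqP; split => [y [_]//|y ->].
Qed.

Lemma esum_bigcup_disjoint (R : realType) (T U : choiceType) (K : set U)
    (J : U -> set T) (a : T -> \bar R) :
  (forall y z x, J y x -> J z x -> y = z) -> (forall x, (0 <= a x)%E) ->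
  (\esum_(x in \bigcup_(y in K) J y) a x = \esum_(y in K) \esum_(x in J y) a x)%E.
Proof.
move=> dJ a0; rewrite esum_esum //; apply: reindex_esum; split.
- by move=> [y x] [/= Ky Jyx]; exists y.
- move=> [y x] [z x'] /set_mem [/= Ky Jyx] /set_mem [/= Kz Jzx] E.
  by rewrite -E in Jzx *; rewrite (dJ _ _ _ Jyx Jzx).
- by move=> x [y Ky Jyx]; exists (y, x).
Qed.

Lemma esum_triangle (R : realType) (G : nat -> nat -> \bar R) :
  (forall i k, (0 <= G i k)%E) ->
  (\esum_(i in [set: nat]) \sum_(k < i.+1) G i k =
   \esum_(k in [set: nat]) \esum_(i in [set i | (k <= i)%N]) G i k)%E.
Proof.
move=> G0.
transitivity (\esum_(i in [set: nat]) \esum_(k in `I_i.+1) G i k)%E.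
  by apply: eq_esum => i _; rewrite esum_fset // (fsbig_ord _ _ (G i)).
rewrite !esum_esum //.
rewrite (reindex_esum ([set: nat] `*`` (fun k => [set i | (k <= i)%N])) _
  (fun x => (x.2, x.1))) //.
split.
- by move=> [i j] [].
- by move=> [i1 i2] [j1 j2] /= _ _ [] -> ->.
- by move=> [i1 i2] [_ /= h] /=; exists (i2, i1).
Qed.

Lemma poweR_le (R : realType) (e : R) (x y : \bar R) :
  0 <= e -> (0 <= x)%E -> (x <= y)%E -> (x `^ e <= y `^ e)%E.
Proof.
move=> e0 x0 xy; apply: gt0_ler_poweR => //; rewrite in_itv /= ?leey ?andbT //.
exact: le_trans xy.
Qed.

Lemma poweRK (R : realType) (e : R) (x : \bar R) :
  e != 0 -> (0 <= x)%E -> ((x `^ e) `^ e^-1 = x)%E.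
Proof. by move=> e0 x0; rewrite -poweRrM mulfV // poweRe1. Qed.

(** * Levels and ancestors in a rooted tree *)

(** The first-visit condition gives uniqueness even at the root, where [par] is stationary. *)
Lemma level_set_uniq (V : Type) (par : V -> V) (xi y : V) i j :
  level_set par xi i y -> level_set par xi j y -> i = j.
Proof.
move=> [yi ni] [yj nj].
by have [ij|ji|//] := ltngtP i j; [case: (nj i ij)|case: (ni j ji)].
Qed.

Lemma ex_level (V : eqType) (par : V -> V) (root : V) :
  is_rooted_tree par root -> forall v, exists j, level_set par root j v.
Proof.
move=> [_ reach] v; have : exists n, iter n par v == root.
  by have [n <-] := reach v; exists n.
move=> /ex_minnP [j /eqP jv jmin]; exists j; split => // k kj /eqP kv.
by have := jmin k kv; rewrite leqNgt kj.
Qed.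

Lemma level_set_iter (V : Type) (par : V -> V) (root y : V) i k :
  level_set par root i y -> (k <= i)%N ->
  level_set par root (i - k) (iter k par y).
Proof.
move=> [yi ni] ki; split; first by rewrite -iterD subnK.
by move=> l li; rewrite -iterD; apply: ni; lia.
Qed.

Lemma level_set_ancestor (V : Type) (par : V -> V) (root y : V) i k :
  level_set par root i y -> (k <= i)%N -> level_set par (iter k par y) k y.
Proof.
move=> yi ki; split => // l lk E.
have := level_set_iter yi ki; rewrite -E => H1.
have li : (l <= i)%N by lia.
by have := level_set_uniq H1 (level_set_iter yi li); lia.
Qed.

Lemma level_set_trans (V : eqType) (par : V -> V) (root xi y : V) j k :
  is_rooted_tree par root -> level_set par root j xi -> level_set par xi k y ->
  level_set par root (j + k) y.
Proof.
move=> tr xj [yk nk]; have [i yi] := ex_level tr y.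
have [ki|ik] := leqP k i.
  have := level_set_iter yi ki; rewrite yk => /(level_set_uniq xj) ->.
  by rewrite subnK.
(* If [i < k], the path from [y] is at the root after [i] steps and stays there, so [xi] is the root
   and was visited before step [k]. *)
have [yi0 _] := yi; case: (nk i ik); rewrite yi0 -yk.
have iterroot n : iter n par root = root.
  by elim: n => //= n ->; case: tr.
by rewrite -(subnK (ltnW ik)) iterD yi0 iterroot.
Qed.

(** The ancestors of [xi] are indexed by their level [k], from the root at [k = 0] to [xi] itself at
    [k = i]; uniqueness of levels makes the indexing injective. *)
Lemma Sop_level (R : realType) (V : choiceType) (par : V -> V) (root : V)
    (u w f : V -> R) i xi :
  is_rooted_tree par root -> level_set par root i xi ->
  Sop par u w f xi =
  w xi * \sum_(k < i.+1) u (iter (i - k) par xi) * f (iter (i - k) par xi).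
Proof.
move=> tr xii; rewrite /Sop; congr (_ * _).
rewrite (fsbig_ord _ _ (fun k => u (iter (i - k) par xi) * f (iter (i - k) par xi))).
apply: (@reindex_fsbig _ _ _ _ _ (fun k => iter (i - k) par xi)); split.
- move=> k /= ki; exists (i - k)%N; apply: level_set_ancestor xii _; lia.
- move=> k l /set_mem /= ki /set_mem /= li E.
  have h1 : (i - k <= i)%N by lia.
  have h2 : (i - l <= i)%N by lia.
  have := level_set_iter xii h1; rewrite E => /(level_set_uniq (level_set_iter xii h2)); lia.
- move=> x [d xd] /=; have [j xj] := ex_level tr x.
  have E := level_set_uniq (level_set_trans tr xj xd) xii.
  exists j => /=; first by lia.
  by have [<- _] := xd; congr (iter _ par xi); lia.
Qed.

Lemma esum_levels (R : realType) (V : choiceType) (par : V -> V) (root : V)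
    (a : V -> \bar R) :
  is_rooted_tree par root -> (forall x, (0 <= a x)%E) ->
  (\esum_(x in [set: V]) a x =
   \esum_(i in [set: nat]) \esum_(x in level_set par root i) a x)%E.
Proof.
move=> tr a0; rewrite -esum_bigcup_disjoint // => [|i j x]; last exact: level_set_uniq.
  congr (esum _ _); apply/seteqP; split => // x _.
  by have [j xj] := ex_level tr x; exists j.
Qed.

Lemma esum_subtree (R : realType) (V : choiceType) (par : V -> V) (xi : V)
    (a : V -> \bar R) :
  (forall x, (0 <= a x)%E) ->
  (\esum_(x in subtree par xi) a x =
   \esum_(i in [set: nat]) \esum_(x in level_set par xi i) a x)%E.
Proof.
move=> a0; rewrite -esum_bigcup_disjoint // => [|i j x]; last exact: level_set_uniq.
  congr (esum _ _); apply/seteqP; split => x; first by move=> [j xj]; exists j.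
  by move=> [j _ xj]; exists j.
Qed.

Lemma eq_ler (R : realType) (x y : R) : x = y -> x <= y.
Proof. by move=> ->. Qed.

(** * The estimate on one level of a regular tree *)

(** The cardinality is written as an unordered sum of ones, which is [+oo] on an infinite set. *)
Definition regular_tree (R : realType) (V : choiceType) (par : V -> V) (root : V)
    (Cst : R) (S : nat -> R) : Prop :=
  forall j xi j', level_set par root j xi -> (j <= j')%N ->
    ((Cst^-1 * (S j' / S j))%:E <= \esum_(y in level_set par xi (j' - j)) 1
     /\ \esum_(y in level_set par xi (j' - j)) 1 <= (Cst * (S j' / S j))%:E)%E.

(** Level [i] splits according to the ancestor [y] on level [k], and each [y] has at most
    [Cst * (S i / S k)] descendants there. *)
Lemma esum_level_ancestor (R : realType) (V : choiceType) (par : V -> V) (root : V)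
    (Cst : R) (S : nat -> R) (F : V -> R) i k :
  is_rooted_tree par root -> 0 < Cst -> (forall j, 0 < S j) ->
  regular_tree par root Cst S -> (forall x, 0 <= F x) -> (k <= i)%N ->
  (\esum_(x in level_set par root i) (F (iter (i - k) par x))%:E <=
   (Cst * (S i / S k))%:E * \esum_(y in level_set par root k) (F y)%:E)%E.
Proof.
move=> tr Cst0 S0 reg F0 ki.
have -> : level_set par root i =
    \bigcup_(y in level_set par root k) level_set par y (i - k).
  apply/seteqP; split => x.
    move=> xi; have h : (i - k <= i)%N by lia.
    exists (iter (i - k) par x); last exact: level_set_ancestor xi h.
    by have := level_set_iter xi h; rewrite subKn.
  by move=> [y yk xy]; have := level_set_trans tr yk xy; rewrite subnKC.
rewrite esum_bigcup_disjoint; last 2 first.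
- by move=> y z x [<- _] [<- _].
- by move=> x; rewrite lee_fin.
have c0 : 0 <= Cst * (S i / S k) by rewrite mulr_ge0 ?divr_ge0 ?ltW.
rewrite -ge0_esumZl //.
apply: le_esum => y yk.
rewrite (_ : (\esum_(x in _) _)%E = ((F y)%:E * \esum_(x in level_set par y (i - k)) 1)%E).
  by rewrite muleC lee_wpmul2r ?lee_fin //; have [] := reg _ _ _ yk ki.
rewrite -ge0_esumZl //; apply: eq_esum => x [-> _].
by rewrite mule1.
Qed.

Lemma level_estimate (R : realType) (p q Cst Rr : R) :
  0 < p -> p < q -> 0 < Cst -> 1 < Rr -> exists2 C : R, 0 < C &
  forall (V : choiceType) (par : V -> V) (root : V) (S : nat -> R),
    is_rooted_tree par root -> (forall j, 0 < S j) ->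
    regular_tree par root Cst S -> (forall j, Rr * S j <= S j.+1) ->
  forall (f : V -> R) (F : nat -> R), (forall x, 0 <= f x) ->
    (forall k, (\esum_(x in level_set par root k) (f x `^ p)%:E = (F k)%:E)%E) ->
  forall i,
    (\esum_(x in level_set par root i)
        ((\sum_(k < i.+1) f (iter (i - k) par x)) `^ q)%:E <=
     (C * (S i * \sum_(k < i.+1) F k `^ (q / p) / S k))%:E)%E.
Proof.
move=> p0 pq Cst0 Rr1; have [C C0 HC] := powR_chain_sum p0 pq Rr1.
have [la0 la1 _] := smoothing_ratioP Rr1.
set la := smoothing_ratio Rr in la0 la1 HC.
(* The factors come from the pointwise inequality, the count of descendants and the total mass of
   the kernel. *)
exists (C * Cst * (2 / (1 - la))).
  by rewrite !mulr_gt0 // invr_gt0 subr_gt0.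
move=> V par root S tr S0 reg Sg f F f0 Ff i.
have F0 k : 0 <= F k.
  by rewrite -lee_fin -Ff; apply: esum_ge0 => x _; rewrite lee_fin powR_ge0.
pose m j := F j `^ (q / p) / S j.
have m0 j : 0 <= m j by rewrite divr_ge0 ?powR_ge0 ?(ltW (S0 _)).
pose K := smoothed la i.+1 m.
have K0 k : 0 <= K k.
  by apply: sumr_ge0 => j _; rewrite mulr_ge0 ?exprn_ge0 ?(ltW la0).
pose c k := C * (S k * K k / F k).
have c0 k : 0 <= c k by rewrite !mulr_ge0 ?invr_ge0 ?(ltW C0) ?(ltW (S0 _)).
apply: (@le_trans _ _ (\esum_(x in level_set par root i)
    \sum_(k < i.+1) ((c k)%:E * (f (iter (i - k) par x) `^ p)%:E))%E).
  apply: le_esum => x xi.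
  under [X in (_ <= X)%E]eq_bigr do rewrite -EFinM.
  rewrite sumEFin lee_fin.
  apply: le_trans (HC i.+1 S F (fun k => f (iter (i - k) par x)) S0 Sg F0 _) _.
    move=> k ki; split => //; rewrite -lee_fin -Ff.
    apply: (@esum_ge_term _ _ _ (fun x => (f x `^ p)%:E)).
    have h : (i - k <= i)%N by lia.
    by have := level_set_iter xi h; rewrite subKn.
  rewrite mulr_sumr; apply: ler_sum => k _.
  by rewrite /c /K /m; apply: eq_ler; ring.
rewrite esum_sum => [|x k _ _]; last by rewrite -EFinM lee_fin mulr_ge0 ?powR_ge0.
apply: (@le_trans _ _ (\sum_(k < i.+1) (C * Cst * S i * K k)%:E)%E).
  apply: lee_sum => k _; rewrite ge0_esumZl // => [|x]; last by rewrite lee_fin powR_ge0.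
  have ki : (k <= i)%N by have := ltn_ord k; lia.
  apply: le_trans (lee_wpmul2l _
    (@esum_level_ancestor _ _ _ _ _ _ (fun x => f x `^ p) _ _ tr Cst0 S0 reg _ ki)) _.
  - by rewrite lee_fin.
  - by move=> x; rewrite powR_ge0.
  rewrite Ff -!EFinM lee_fin /c.
  have [->|Fk] := eqVneq (F k) 0.
    by rewrite !mulr0 !mulr_ge0 ?(ltW C0) ?(ltW Cst0) ?(ltW (S0 _)).
  by apply: eq_ler; field; rewrite Fk gt_eqF.
rewrite sumEFin lee_fin -mulr_sumr.
have -> : C * Cst * (2 / (1 - la)) * (S i * \sum_(k < i.+1) F k `^ (q / p) / S k) =
  C * Cst * S i * (2 / (1 - la) * \sum_(k < i.+1) m k) by ring.
by rewrite ler_wpM2l ?mulr_ge0 ?(ltW C0) ?(ltW Cst0) ?(ltW (S0 _)) // sum_smoothed // ltW.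
Qed.

(** * The upper bound for the operator norm *)

Lemma poweR_prod_le (R : realType) (q u b : R) (T : \bar R) :
  0 < q -> 0 <= u -> 0 <= b -> (0 <= T)%E ->
  (u%:E * T `^ q^-1 <= b%:E)%E -> ((u `^ q)%:E * T <= (b `^ q)%:E)%E.
Proof.
move=> q0 u0 b0 T0 H.
rewrite -!poweR_EFin -[in leLHS](@poweRK _ q^-1 T) ?invrK //; last by rewrite invr_eq0 gt_eqF.
rewrite -poweRM ?lee_fin ?poweR_ge0 //; apply: poweR_le => //; first exact: ltW.
by rewrite mule_ge0 ?poweR_ge0 ?lee_fin.
Qed.

Lemma poweR_leZ (R : realType) (e c : R) (x y : \bar R) :
  0 <= e -> 0 <= c -> (0 <= x)%E -> (0 <= y)%E ->
  (x <= c%:E * y)%E -> (x `^ e <= (c `^ e)%:E * y `^ e)%E.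
Proof.
by move=> e0 c0 x0 y0 xy; rewrite -poweR_EFin -poweRM ?lee_fin //; exact: poweR_le.
Qed.

Lemma op_norm_upper (R : realType) (p q Cst Rr : R) :
  0 < p -> p < q -> 0 < Cst -> 1 < Rr -> exists2 C : R, 0 < C &
  forall (V : choiceType) (par : V -> V) (root : V) (u w : V -> R)
      (uj wj S : nat -> R),
    is_rooted_tree par root ->
    (forall j, 0 <= uj j) -> (forall j, 0 <= wj j) ->
    (forall j xi, level_set par root j xi -> u xi = uj j /\ w xi = wj j) ->
    (forall j, 0 < S j) -> regular_tree par root Cst S ->
    (forall j, Rr * S j <= S j.+1) ->
  (op_norm par root p q u w <= C%:E * ereal_sup [set ((uj j)%:E *
       (\esum_(i in [set i : nat | (j <= i)%N])
           ((wj i `^ q * (S i / S j))%:E)) `^ q^-1)%E | j in [set: nat]])%E.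
Proof.
move=> p0 pq Cst0 Rr1; have [C C0 HC] := level_estimate p0 pq Cst0 Rr1.
have q0 : 0 < q by apply: lt_trans pq.
(* The level estimate concerns [q]-th powers, hence the root. *)
exists (C `^ q^-1); first by rewrite powR_gt0.
move=> V par root u w uj wj S tr uj0 wj0 uw S0 reg Sg.
set T := fun j => (\esum_(i in [set i : nat | (j <= i)%N]) ((wj i `^ q * (S i / S j))%:E))%E.
set B := ereal_sup _.
have T0 j : (0 <= T j)%E.
  by apply: esum_ge0 => i _; rewrite lee_fin mulr_ge0 ?powR_ge0 // divr_ge0 ?ltW.
have TB j : ((uj j)%:E * T j `^ q^-1 <= B)%E by apply: ereal_sup_ubound; exists j.
have B0 : (0 <= B)%E.
  by apply: le_trans (TB 0%N); rewrite mule_ge0 ?poweR_ge0 ?lee_fin.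
have [Boo|] := eqVneq B +oo%E.
  by rewrite Boo mulry gtr0_sg ?powR_gt0 // mul1e leey.
move: B0 TB; case: B => [b| |] // b0 TB _; rewrite lee_fin in b0.
have uTb j : ((uj j `^ q)%:E * T j <= (b `^ q)%:E)%E by apply: poweR_prod_le.
apply: ereal_inf_lbound; split.
  by rewrite -EFinM lee_fin mulr_ge0 ?powR_ge0.
move=> f finf.
have u0 x : 0 <= u x by have [j xj] := ex_level tr x; have [-> _] := uw _ _ xj.
pose P k := (\esum_(x in level_set par root k) (`|f x| `^ p)%:E)%E.
have P0 k : (0 <= P k)%E by apply: esum_ge0 => x _; rewrite lee_fin powR_ge0.
pose N := (\esum_(j in [set: nat]) (P j `^ (q / p)))%E.
have N0 : (0 <= N)%E by apply: esum_ge0 => x _; rewrite poweR_ge0.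
have Noo : (N < +oo)%E by apply: lty_poweRy finf; rewrite invr_eq0 gt_eqF.
have qp0 : 0 < q / p by rewrite divr_gt0.
(* A finite mixed norm makes every level sum finite, so the level estimate can be used with real
   values [F k]. *)
have Pfin k : P k \is a fin_num.
  rewrite ge0_fin_numE //; apply: (@lty_poweRy _ _ (q / p)); first by rewrite gt_eqF.
  by apply: le_lt_trans Noo; apply: (@esum_ge_term _ _ _ (fun k => P k `^ (q / p))%E).
pose F k := fine (P k).
have F0 k : 0 <= F k by rewrite fine_ge0.
have PF k : P k = (F k)%:E by rewrite fineK.
suff main : (\esum_(x in [set: V]) (`|Sop par u w f x| `^ q)%:E <=
    (C * b `^ q)%:E * N)%E.
  rewrite /lq_norm.
  apply: le_trans (poweR_le _ _ main) _.
  - by rewrite invr_ge0 ltW.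
  - by apply: esum_ge0 => x _; rewrite lee_fin powR_ge0.
  rewrite poweRM ?lee_fin ?mulr_ge0 ?powR_ge0 ?(ltW C0) // poweR_EFin.
  rewrite powRM ?powR_ge0 ?(ltW C0) // -powRrM mulfV ?gt_eqF // powRr1 //.
have fp x : 0 <= u x * `|f x| by rewrite mulr_ge0.
have Fp k : (\esum_(x in level_set par root k) ((u x * `|f x|) `^ p)%:E =
    (uj k `^ p * F k)%:E)%E.
  rewrite EFinM -PF -ge0_esumZl ?powR_ge0 //.
  by apply: eq_esum => x xk; have [-> _] := uw _ _ xk; rewrite powRM // EFinM.
have lev i := HC V par root S tr S0 reg Sg _ _ fp Fp i.
rewrite (esum_levels tr) => [|x]; last by rewrite lee_fin powR_ge0.
(* [G i k] bounds the contribution of level [k] of [f] to level [i] of the image. *)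
pose G i k : \bar R := ((C * F k `^ (q / p) * uj k `^ q)%:E * (wj i `^ q * (S i / S k))%:E)%E.
have G0 i k : (0 <= G i k)%E.
  by rewrite /G -EFinM lee_fin !mulr_ge0 ?invr_ge0 ?powR_ge0 ?(ltW C0) ?(ltW (S0 _)).
apply: (@le_trans _ _ (\esum_(i in [set: nat]) \sum_(k < i.+1) G i k)%E).
  apply: le_esum => i _.
  apply: (@le_trans _ _ ((wj i `^ q)%:E * \esum_(x in level_set par root i)
     ((\sum_(k < i.+1) u (iter (i - k) par x) * `|f (iter (i - k) par x)|) `^ q)%:E)%E).
    rewrite -ge0_esumZl ?powR_ge0 // => [|x]; last by rewrite lee_fin powR_ge0.
    apply: le_esum => x xi; rewrite (Sop_level _ _ _ tr xi).
    have [_ ->] := uw _ _ xi.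
    rewrite normrM (ger0_norm (wj0 i)) powRM // EFinM lee_wpmul2l ?lee_fin ?powR_ge0 //.
    apply: ge0_ler_powR; rewrite ?nnegrE ?(ltW q0) //.
      by apply: sumr_ge0 => k _; exact: fp.
    apply: le_trans (ler_norm_sum _ _ _) _; apply: ler_sum => k _.
    by rewrite normrM ger0_norm.
  apply: (@le_trans _ _ ((wj i `^ q)%:E * (C * (S i * \sum_(k < i.+1)
      (uj k `^ p * F k) `^ (q / p) / S k))%:E)%E).
    by apply: lee_wpmul2l; [rewrite lee_fin powR_ge0|exact: lev].
  under [X in (_ <= X)%E]eq_bigr do rewrite /G -EFinM.
  rewrite sumEFin -EFinM lee_fin !mulr_sumr; apply: ler_sum => k _.
  apply: eq_ler; rewrite powRM ?powR_ge0 // -powRrM (mulrC p) divfK ?gt_eqF //.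
  by field; rewrite gt_eqF.
(* After the exchange, the sum over [i >= k] is [T k] times a factor containing [uj k ^ q], and
   [uj k ^ q * T k <= b ^ q]. *)
rewrite esum_triangle //.
have Cb0 : 0 <= C * b `^ q by rewrite mulr_ge0 ?powR_ge0 // ltW.
rewrite -ge0_esumZl // => [|x]; last exact: poweR_ge0.
apply: le_esum => k _.
rewrite ge0_esumZl; last 2 first.
- by move=> i; rewrite lee_fin mulr_ge0 ?powR_ge0 // divr_ge0 ?ltW.
- by rewrite !mulr_ge0 ?powR_ge0 ?(ltW C0).
rewrite PF poweR_EFin EFinM -muleA.
apply: le_trans (lee_wpmul2l _ (uTb k)) _.
  by rewrite lee_fin mulr_ge0 ?powR_ge0 ?(ltW C0).
by rewrite -!EFinM lee_fin; apply: eq_ler; ring.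
Qed.

(** * The lower bound and the comparison of the two suprema *)

(** The indicator of [xi] has mixed norm 1, and its image equals [u xi * w] on the subtree above
    [xi]. *)
Lemma op_norm_lower (R : realType) (V : choiceType) (par : V -> V) (root : V)
    (p q : R) (u w : V -> R) :
  0 < p -> 0 < q -> is_rooted_tree par root -> (forall x, 0 <= u x) ->
  (ereal_sup [set ((u xi)%:E * lq_norm q (subtree par xi) w)%E | xi in [set: V]]
   <= op_norm par root p q u w)%E.
Proof.
move=> p0 q0 tr u0; apply: ge_ereal_sup => _ [xi _ <-].
apply: le_ereal_inf_tmp => C [C0 HC].
pose f (x : V) : R := (x == xi)%:R.
have fz x : x <> xi -> f x = 0 by move=> /eqP /negbTE; rewrite /f => ->.
have fxi : f xi = 1 by rewrite /f eqxx.
have [j xj] := ex_level tr xi.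
have N1 : lqlp_norm par root p q f = 1%E.
  have lj : (\esum_(x in level_set par root j) (`|f x| `^ p)%:E = 1)%E.
    rewrite (@esum_single _ _ _ _ xi) ?fxi ?normr1 ?powR1 // => y _ yx.
    by rewrite fz // normr0 powR0 // gt_eqF.
  rewrite /lqlp_norm (@esum_single _ _ _ _ j) ?lj ?poweR1r // => k _ kj.
  rewrite esum1 ?poweR0r ?gt_eqF ?divr_gt0 // => x xk.
  rewrite fz ?normr0 ?powR0 ?gt_eqF // => xxi; apply: kj.
  by rewrite xxi in xk; exact: level_set_uniq xk xj.
have := HC f; rewrite N1 mule1 => /(_ (ltry _)); apply: le_trans.
have uE : ((u xi)%:E = ((u xi `^ q)%:E) `^ q^-1)%E.
  by rewrite poweR_EFin -powRrM mulfV ?gt_eqF // powRr1.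
rewrite /lq_norm uE -poweRM; last 2 first.
- by rewrite lee_fin powR_ge0.
- by apply: esum_ge0 => x _; rewrite lee_fin powR_ge0.
apply: poweR_le; first by rewrite invr_ge0 ltW.
  by rewrite mule_ge0 ?lee_fin ?powR_ge0 // esum_ge0 // => x _; rewrite lee_fin powR_ge0.
apply: le_trans (esum_subset _ (@subsetT _ (subtree par xi))).
rewrite -ge0_esumZl ?powR_ge0 //.
apply: le_esum => y xiy; rewrite lee_fin /Sop.
(* Among the ancestors of [y] only [xi] contributes. *)
rewrite -(@fsbig_widen _ _ _ _ [set xi]) /=; last 2 first.
- by move=> x ->.
- by move=> x [_ /= xxi]; rewrite fz ?mulr0.
by rewrite fsbig_set1 fxi mulr1 normrM powRM // (ger0_norm (u0 xi)) mulrC.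
Qed.

(** The vertices at distance [k] above [xi] lie on level [j + k], where [w] is constant, and their
    number is [S (j + k) / S j] up to the factor [Cst]. The [q]-th root turns [Cst] into
    [Cst ^ (1 / q)]. *)
Lemma subtree_norm_bounds (R : realType) (V : choiceType) (par : V -> V) (root : V)
    (q Cst : R) (w : V -> R) (wj S : nat -> R) j xi :
  0 < q -> 0 < Cst -> is_rooted_tree par root -> (forall j, 0 <= wj j) ->
  (forall j xi, level_set par root j xi -> w xi = wj j) ->
  (forall j, 0 < S j) -> regular_tree par root Cst S -> level_set par root j xi ->
  let T := ((\esum_(i in [set i : nat | (j <= i)%N])
              ((wj i `^ q * (S i / S j))%:E)) `^ q^-1)%E in
  (lq_norm q (subtree par xi) w <= (Cst `^ q^-1)%:E * T)%E /\
  (T <= (Cst `^ q^-1)%:E * lq_norm q (subtree par xi) w)%E.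
Proof.
move=> q0 Cst0 tr wj0 wE S0 reg xj.
pose W k := (\esum_(x in level_set par xi k) 1 : \bar R)%E.
have c0 k : 0 <= wj (j + k)%N `^ q by exact: powR_ge0.
have W0 k : (0 <= W k)%E by apply: esum_ge0.
have EL : (\esum_(x in subtree par xi) (`|w x| `^ q)%:E =
    \esum_(k in [set: nat]) ((wj (j + k)%N `^ q)%:E * W k))%E.
  rewrite esum_subtree => [|x]; last by rewrite lee_fin powR_ge0.
  apply: eq_esum => k _; rewrite -ge0_esumZl //; apply: eq_esum => x xk.
  by rewrite (wE _ _ (level_set_trans tr xj xk)) ger0_norm // mule1.
have ET : (\esum_(i in [set i : nat | (j <= i)%N]) (wj i `^ q * (S i / S j))%:E =
    \esum_(k in [set: nat]) ((wj (j + k)%N `^ q * (S (j + k)%N / S j))%:E))%E.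
  apply: (@reindex_esum _ _ _ _ _ (fun k => (j + k)%N)); split.
  - by move=> k _ /=; rewrite leq_addr.
  - by move=> k l _ _ /addnI.
  - by move=> i /= ji; exists (i - j)%N => //; rewrite subnKC.
have WB k : ((Cst^-1 * (S (j + k)%N / S j))%:E <= W k /\
    W k <= (Cst * (S (j + k)%N / S j))%:E)%E.
  by have := reg _ _ _ xj (leq_addr k j); rewrite addKn.
have t0 k : (0 <= (wj (j + k)%N `^ q * (S (j + k)%N / S j))%:E)%E.
  by rewrite lee_fin mulr_ge0 // divr_ge0 ?ltW.
have e0 : 0 <= q^-1 by rewrite invr_ge0 ltW.
have L0 k : (0 <= (wj (j + k)%N `^ q)%:E * W k)%E by rewrite mule_ge0 ?lee_fin.
rewrite /lq_norm EL ET; split; apply: poweR_leZ; rewrite ?(ltW Cst0) ?esum_ge0 //;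
  rewrite -ge0_esumZl ?(ltW Cst0) //; apply: le_esum => k _; have [H1 H2] := WB k.
  apply: le_trans (lee_wpmul2l _ H2) _; rewrite ?lee_fin //.
  by apply: eq_ler; ring.
rewrite muleCA.
apply: le_trans (lee_wpmul2l _ (lee_wpmul2l _ H1)); rewrite ?lee_fin ?(ltW Cst0) //.
by apply: eq_ler; field; rewrite !gt_eqF.
Qed.

(** The lower cardinality bound is positive, so no level is empty. This lets each index [j] of one
    supremum be matched with a vertex of the other. *)
Lemma ex_level_set (R : realType) (V : choiceType) (par : V -> V) (root : V)
    (Cst : R) (S : nat -> R) j :
  0 < Cst -> (forall j, 0 < S j) -> regular_tree par root Cst S ->
  exists xi, level_set par root j xi.
Proof.
move=> Cst0 S0 reg; apply: contrapT => /forallNP no.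
have r0 : level_set par root 0 root by split.
have [+ _] := reg _ _ _ r0 (leq0n j).
rewrite subn0 esum1 => [|y /no //].
by rewrite leNgt lte_fin mulr_gt0 ?invr_gt0 // divr_gt0.
Qed.

Theorem theorem2 (R : realType) (p q Cst Rr R0 : R) :
  1 < p -> p < q -> 1 <= Cst -> 1 < Rr -> Rr <= R0 ->
  exists c1 c2 : R, 0 < c1 /\ 0 < c2 /\
  forall (V : countType) (par : V -> V) (root : V)
         (u w : V -> R) (uj wj : nat -> R) (S : nat -> R),
    is_rooted_tree par root ->
    (forall j, 0 <= uj j) -> (forall j, 0 <= wj j) ->
    (forall j xi, level_set par root j xi -> u xi = uj j /\ w xi = wj j) ->
    (forall j, 0 < S j) ->
    (forall j xi j', level_set par root j xi -> (j <= j')%N ->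
       ((Cst^-1 * (S j' / S j))%:E <= \esum_(y in level_set par xi (j' - j)) 1
        /\ \esum_(y in level_set par xi (j' - j)) 1 <= (Cst * (S j' / S j))%:E)%E) ->
    S 0%N = 1 ->
    (forall j, S j.+1 / S j <= R0 /\ Rr <= S j.+1 / S j) ->
    let A := op_norm par root p q u w in
    let B1 := ereal_sup [set ((uj j)%:E *
                  (\esum_(i in [set i : nat | (j <= i)%N])
                      ((wj i `^ q * (S i / S j))%:E)) `^ q^-1)%E | j in [set: nat]] in
    let B2 := ereal_sup [set ((u xi)%:E * lq_norm q (subtree par xi) w)%E
                        | xi in [set: V]] in
    asymp c1 c2 A B1 /\ asymp c1 c2 B1 B2 /\ asymp c1 c2 A B2.
Proof.
move=> p1 pq Cst1 Rr1 _.
have p0 : 0 < p by lra.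
have q0 : 0 < q by lra.
have Cst0 : 0 < Cst by lra.
have [D D0 HD] := op_norm_upper p0 pq Cst0 Rr1.
pose k := Cst `^ q^-1.
have k0 : 0 < k by rewrite powR_gt0.
have k1 : 1 <= k.
  have := @ler_powR _ Cst Cst1 0 q^-1; rewrite powRr0; apply.
  by rewrite invr_ge0 ltW.
have Dk0 : 0 < D * k by rewrite mulr_gt0.
(* The upper constants of the three comparisons are [D], [k] and [D * k], all below their sum. The
   lower constant [k^-1] serves all three since [k >= 1]. *)
exists k^-1, (D + k + D * k); split; first by rewrite invr_gt0.
split; first by lra.
move=> V par root u w uj wj S tr uj0 wj0 uw S0 reg _ Sg A B1 B2.
have {}Sg j : Rr * S j <= S j.+1 by have [_] := Sg j; rewrite ler_pdivlMr.
have u0 x : 0 <= u x by have [j xj] := ex_level tr x; have [-> _] := uw _ _ xj.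
have wE j x (xj : level_set par root j x) : w x = wj j by have [] := uw _ _ xj.
have cmp j x := subtree_norm_bounds (j := j) (xi := x) q0 Cst0 tr wj0 wE S0 reg.
have AB1 : (A <= D%:E * B1)%E by exact: HD.
have B2A : (B2 <= A)%E by exact: op_norm_lower.
have B1k : (B1 <= k%:E * B2)%E.
  apply: ge_ereal_sup => _ [j _ <-].
  have [x xj] := ex_level_set j Cst0 S0 reg.
  have [_ H] := cmp j x xj; have [<- _] := uw _ _ xj.
  apply: le_trans (lee_wpmul2l _ H) _; first by rewrite lee_fin.
  rewrite muleCA lee_wpmul2l ?lee_fin ?(ltW k0) //.
  by apply: ereal_sup_ubound; exists x.
have B2k : (B2 <= k%:E * B1)%E.
  apply: ge_ereal_sup => _ [x _ <-].
  have [j xj] := ex_level tr x.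
  have [H _] := cmp j x xj; have [-> _] := uw _ _ xj.
  apply: le_trans (lee_wpmul2l _ H) _; first by rewrite lee_fin.
  rewrite muleCA lee_wpmul2l ?lee_fin ?(ltW k0) //.
  by apply: ereal_sup_ubound; exists j.
(* Nonnegativity of the suprema is what allows the constants to be enlarged. *)
have B20 : (0 <= B2)%E.
  apply: (@le_trans _ _ ((u root)%:E * lq_norm q (subtree par root) w)%E).
    by rewrite mule_ge0 ?lee_fin ?poweR_ge0.
  by apply: ereal_sup_ubound; exists root.
have B10 : (0 <= B1)%E by rewrite -(@lee_pmul2l _ k%:E) // mule0 (le_trans B20).
have widen c B : (0 <= B)%E -> c <= D + k + D * k ->
    (c%:E * B <= (D + k + D * k)%:E * B)%E.
  by move=> B0 cle; rewrite lee_wpmul2r ?lee_fin.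
split; [|split]; split.
- by rewrite lee_pdivrMl //; apply: le_trans B1k _; rewrite lee_wpmul2l ?lee_fin ?(ltW k0).
- by apply: le_trans AB1 _; apply: widen => //; lra.
- by rewrite lee_pdivrMl.
- by apply: le_trans B1k _; apply: widen => //; lra.
- apply: le_trans B2A; rewrite lee_pdivrMl //.
  by rewrite -[leLHS]mul1e lee_wpmul2r ?lee_fin.
- apply: (le_trans AB1); apply: (@le_trans _ _ (D%:E * (k%:E * B2))%E).
    by rewrite lee_wpmul2l ?lee_fin ?(ltW D0).
  by rewrite muleA -EFinM; apply: widen => //; lra.
Qed.
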